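(* Let $n=2$, let $R_+>R_->0$, $\psi>0$ and $\gamma_0\ge0$ be constants, and let $d_k$ be a sequence of positive real numbers tending to $0$. For each $k$ define $$\phi_k=d_k-\frac{\gamma_0}2\Big[R_-d_k-\psi\Big(R_-^2-\frac{d_k^2}{\psi^2}\Big)\ln\Big(R_-+\frac{d_k}\psi\Big)\Big]+\frac{\psi\gamma_0}2\Big[R_+\sqrt{R_+^2-R_-^2+\tfrac{d_k^2}{\psi^2}}-\Big(R_-^2-\frac{d_k^2}{\psi^2}\Big)\ln\Big(R_++\sqrt{R_+^2-R_-^2+\tfrac{d_k^2}{\psi^2}}\Big)\Big].$$ Then the strictly convex radial solution $u^{(k)}$ of $$\begin{cases}\det[D^2u^{(k)}]=\psi^2&\text{in }\Omega=B_{R_+}\setminus\overline{B_{R_-}},\\ u^{(k)}=0&\text{on }\Gamma^+=\partial B_{R_+},\\ u^{(k)}_\nu=\gamma_0u^{(k)}+\phi_k&\text{on }\Gamma^-=\partial B_{R_-},\end{cases}$$ is given by $$u^{(k)}(x)=\frac\psi2\Big[|x|\sqrt{|x|^2-R_-^2+\tfrac{d_k^2}{\psi^2}}-\Big(R_-^2-\frac{d_k^2}{\psi^2}\Big)\ln\Big(|x|+\sqrt{|x|^2-R_-^2+\tfrac{d_k^2}{\psi^2}}\Big)-R_+\sqrt{R_+^2-R_-^2+\tfrac{d_k^2}{\psi^2}}+\Big(R_-^2-\frac{d_k^2}{\psi^2}\Big)\ln\Big(R_++\sqrt{R_+^2-R_-^2+\tfrac{d_k^2}{\psi^2}}\Bi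g)\Big].$$
   Context: $B_R\subset\mathbb{R}^2$ is the open disc of radius $R$ centred at the origin. $\nu$ is the unit normal on $\Gamma^-$ pointing into $\Omega$, i.e. $\nu=x/|x|$. A function is strictly convex if its Hessian is positive definite, and radial if it depends only on $|x|$. *)

(* Defs.v *)
From HB Require Import structures.
From mathcomp Require Import all_boot all_order all_algebra.
From mathcomp Require Import all_classical all_reals all_analysis.
Import Order.TTheory GRing.Theory Num.Theory.
Import numFieldNormedType.Exports.

Set Implicit Arguments.
Unset Strict Implicit.
Unset Printing Implicit Defensive.

Local Open Scope classical_set_scope.
Local Open Scope ring_scope.

(* The library norm `|x| on row vectors is the sup norm; it induces the usual
   topology, but |x| below is the Euclidean norm. *)
Definition enorm (R : realType) (n : nat) (x : 'rV[R]_n) : R :=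
  Num.sqrt (\sum_(i < n) x 0 i ^+ 2).

Definition disc (R : realType) (r : R) : set 'rV[R]_2 :=
  [set x | enorm x < r].

Definition boundary (T : topologicalType) (A : set T) : set T :=
  closure A `\` interior A.

Definition annulus (R : realType) (Rm Rp : R) : set 'rV[R]_2 :=
  disc Rp `\` closure (disc Rm).

Definition partial (R : realType) (n : nat) (i : 'I_n) (u : 'rV[R]_n -> R) :
    'rV[R]_n -> R :=
  fun x => 'D_(delta_mx 0 i) u x.

(* The partial derivatives at x are those of u as a function on all of R^n;
   at a point x of A on the boundary of A this requires u to be regular in a
   full neighbourhood of x. *)
Definition C2_on (R : realType) (n : nat) (A : set 'rV[R]_n)
    (u : 'rV[R]_n -> R) : Prop :=
  forall x, A x ->
    {for x, continuous u} /\
    (forall i : 'I_n,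
       derivable u x (delta_mx 0 i) /\ {for x, continuous (partial i u)}) /\
    (forall i j : 'I_n,
       derivable (partial i u) x (delta_mx 0 j) /\
       {for x, continuous (partial j (partial i u))}).

Definition hessian (R : realType) (n : nat) (u : 'rV[R]_n -> R)
    (x : 'rV[R]_n) : 'M[R]_n :=
  \matrix_(i < n, j < n) partial j (partial i u) x.

Definition posdef (R : realType) (n : nat) (A : 'M[R]_n) : Prop :=
  A^T = A /\ forall v : 'rV[R]_n, v != 0 -> 0 < (v *m A *m v^T) 0 0.

Definition strictly_convex_on (R : realType) (n : nat) (A : set 'rV[R]_n)
    (u : 'rV[R]_n -> R) : Prop :=
  forall x, A x -> posdef (hessian u x).

Definition radial_on (R : realType) (n : nat) (A : set 'rV[R]_n)
    (u : 'rV[R]_n -> R) : Prop :=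
  forall x y, A x -> A y -> enorm x = enorm y -> u x = u y.

(* One-sided derivative of u at x along v, so that at a point of the inner
   circle, with v pointing into the annulus, only values of u on the closed
   annulus are involved. *)
Definition is_onesided_derivative (R : realType) (n : nat)
    (u : 'rV[R]_n -> R) (x v : 'rV[R]_n) (l : R) : Prop :=
  h^-1 * (u (x + h *: v) - u x) @[h --> 0^'+] --> l.

Definition inner_normal (R : realType) (x : 'rV[R]_2) : 'rV[R]_2 :=
  (enorm x)^-1 *: x.

Definition solves_problem (R : realType) (Rm Rp psi gamma0 phi : R)
    (u : 'rV[R]_2 -> R) : Prop :=
  [/\ forall x, annulus Rm Rp x -> \det (hessian u x) = psi ^+ 2,
      forall x, boundary (disc Rp) x -> u x = 0
    & forall x, boundary (disc Rm) x ->
        is_onesided_derivative u x (inner_normal x) (gamma0 * u x + phi)].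

Definition phi_of (R : realType) (Rm Rp psi gamma0 d : R) : R :=
  d
  - gamma0 / 2 *
      (Rm * d
       - psi * (Rm ^+ 2 - d ^+ 2 / psi ^+ 2) * ln (Rm + d / psi))
  + psi * gamma0 / 2 *
      (Rp * Num.sqrt (Rp ^+ 2 - Rm ^+ 2 + d ^+ 2 / psi ^+ 2)
       - (Rm ^+ 2 - d ^+ 2 / psi ^+ 2)
         * ln (Rp + Num.sqrt (Rp ^+ 2 - Rm ^+ 2 + d ^+ 2 / psi ^+ 2))).

Definition u_of (R : realType) (Rm Rp psi d : R) (x : 'rV[R]_2) : R :=
  psi / 2 *
    (enorm x * Num.sqrt (enorm x ^+ 2 - Rm ^+ 2 + d ^+ 2 / psi ^+ 2)
     - (Rm ^+ 2 - d ^+ 2 / psi ^+ 2)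
       * ln (enorm x + Num.sqrt (enorm x ^+ 2 - Rm ^+ 2 + d ^+ 2 / psi ^+ 2))
     - Rp * Num.sqrt (Rp ^+ 2 - Rm ^+ 2 + d ^+ 2 / psi ^+ 2)
     + (Rm ^+ 2 - d ^+ 2 / psi ^+ 2)
       * ln (Rp + Num.sqrt (Rp ^+ 2 - Rm ^+ 2 + d ^+ 2 / psi ^+ 2))).

(* Main.v *)
(* Existence: as a function of [t = |x|^2] the given solution has derivative
   [H(t) / 2] with [H(t) = psi sqrt((t - m) / t)], [m = R_-^2 - d^2 / psi^2], so
   its gradient is [H(|x|^2) x]; the boundary term [phi_k] is exactly what makes
   the Robin condition hold, the normal derivative at the inner circle being [d].
   Uniqueness: on a radius [u = f(r)] the equation reads [f' f'' = psi^2 r], so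
   [f'^2 = psi^2 r^2 + C].  For two solutions with [C1 > C2] the difference
   [f1 - f2] increases strictly to [0] at [R_+], which contradicts the Robin
   condition at [R_-] since [gamma0 >= 0]; hence [C1 = C2] and [f1 = f2]. *)
Require Import Defs.
From HB Require Import structures.
From mathcomp Require Import all_boot all_order all_algebra.
From mathcomp Require Import all_classical all_reals all_analysis.
From mathcomp Require Import ring lra.
Import Order.TTheory GRing.Theory Num.Theory.
Import numFieldNormedType.Exports.

Local Open Scope classical_set_scope.
Local Open Scope ring_scope.

(** * Directional derivatives as one-variable derivatives along lines *)

Section DerivativeAlongLines.
Context {R : realType} {V : normedModType R}.
Implicit Types (f q : V -> R) (x v : V).

(** Both difference quotients are the same function of [h], so existence and value of the derivative
    transfer together. *)
Lemma is_derive_line {f} {x v} (s : R) {l : R} :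
  is_derive (s *: v + x) v f l <-> is_derive s 1 (fun r => f (r *: v + x)) l.
Proof.
have E : (fun h : R => h^-1 *: ((f \o shift (s *: v + x)) (h *: v)
                             - f (s *: v + x))) =
  (fun h : R => h^-1 *: (((fun r => f (r *: v + x)) \o shift s) (h *: 1)
                             - f (s *: v + x))).
  by apply/funext => h /=; rewrite scalerDl addrA [h *: 1]mulr1.
by split=> -[]; rewrite /derivable /derive ?E -?E => df dfE; split;
  rewrite ?/derivable ?/derive ?E -?E.
Qed.

Lemma is_derive_line0 {f} {x v} {l : R} :
  is_derive x v f l <-> is_derive (0 : R) 1 (fun r => f (r *: v + x)) l.
Proof. by rewrite -is_derive_line scale0r add0r. Qed.

(** This chain rule asks only for a directional derivative of [q]: on the line through [x] it is the
    one-variable chain rule. *)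
Lemma is_derive_comp_line {G : R -> R} {q} {x v} {a b : R} :
  is_derive (q x) 1 G a -> is_derive x v q b -> is_derive x v (G \o q) (a * b).
Proof.
move=> dG /is_derive_line0 dq; apply/is_derive_line0.
by apply: (@is_derive1_comp _ G); rewrite ?scale0r ?add0r.
Qed.

Lemma is_derive_onesided {f} {x v} {l : R} : is_derive x v f l ->
  h^-1 * (f (x + h *: v) - f x) @[h --> 0^'+] --> l.
Proof.
move=> [dfx <-]; apply: cvg_dnbhs_at_right; rewrite /derive.
have -> : (fun h : R => h^-1 * (f (x + h *: v) - f x)) =
    (fun h => h^-1 *: ((f \o shift x) (h *: v) - f x)).
  by apply/funext => h /=; rewrite (addrC x).
exact: dfx.
Qed.

End DerivativeAlongLines.

(** * Euclidean norm, discs and annuli in the plane *)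

Section PlanarCalculus.
Context {R : realType}.
Implicit Types (x v : 'rV[R]_2).

Definition dot2 x v : R := x 0 0 * v 0 0 + x 0 1 * v 0 1.

Lemma is_derive_coord x v (j : 'I_2) :
  is_derive x v (fun y : 'rV[R]_2 => y 0 j) (v 0 j).
Proof.
apply/is_derive_line0; rewrite (_ : (fun r => _) =
  (fun r : R => r * v 0 j + x 0 j)); last by apply/funext => r; rewrite !mxE.
by apply: is_derive_eq; rewrite /GRing.scale /=; ring.
Qed.

Lemma is_derive_dot2 x v :
  is_derive x v (fun y : 'rV[R]_2 => dot2 y y) (2 * dot2 x v).
Proof.
have d0 := is_derive_coord x v 0; have d1 := is_derive_coord x v 1.
apply: (is_derive_eq (is_deriveD (is_deriveM d0 d0) (is_deriveM d1 d1))).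
by rewrite /dot2 /GRing.scale /=; ring.
Qed.

Lemma enormE x : enorm x = Num.sqrt (dot2 x x).
Proof.
rewrite /enorm !big_ord_recl big_ord0 addr0 !expr2.
by congr (Num.sqrt (_ + x 0 _ * x 0 _)); apply/val_inj.
Qed.

Lemma dot2_ge0 x : 0 <= dot2 x x.
Proof. by rewrite /dot2 -!expr2 addr_ge0 ?sqr_ge0. Qed.

Lemma enorm_ge0 x : 0 <= enorm x.
Proof. exact: sqrtr_ge0. Qed.

Lemma enorm_sqr x : enorm x ^+ 2 = dot2 x x.
Proof. by rewrite enormE sqr_sqrtr ?dot2_ge0. Qed.

Lemma enormZ (a : R) x : enorm (a *: x) = `|a| * enorm x.
Proof.
rewrite !enormE -sqrtr_sqr -sqrtrM ?sqr_ge0//; congr Num.sqrt.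
by rewrite /dot2 !mxE; ring.
Qed.

Lemma dot2_continuous : continuous (fun x : 'rV[R]_2 => dot2 x x).
Proof.
move=> x; rewrite /dot2.
by apply: (@continuousD _ _ _ (fun y : 'rV[R]_2 => y 0 0 * y 0 0)
    (fun y : 'rV[R]_2 => y 0 1 * y 0 1));
  apply: (@continuousM _ _ (fun y : 'rV[R]_2 => y 0 _)
    (fun y : 'rV[R]_2 => y 0 _)); exact: coord_continuous.
Qed.

Lemma enorm_continuous : continuous (@enorm R 2).
Proof.
move=> x; rewrite (_ : @enorm R 2 = Num.sqrt \o (fun x => dot2 x x)); last first.
  by apply/funext => y /=; rewrite enormE.
by apply: continuous_comp; [exact: dot2_continuous|exact: sqrt_continuous].
Qed.

Lemma open_disc (r : R) : open (@disc R r).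
Proof.
apply: (@open_comp _ _ (@enorm R 2) [set y | y < r]) => [x _|].
  exact: enorm_continuous.
exact: open_lt.
Qed.

(** Adherence is tested along a single ray; for discs and annuli a radial one suffices. *)
Lemma closure_near_ray (A : set 'rV[R]_2) x v :
  (\forall h \near (0 : R)^'+, A (x + h *: v)) -> closure A x.
Proof.
move=> nA B xB.
have : \forall h \near (0 : R)^'+, B (x + h *: v).
  have : x + h *: v @[h --> (0 : R)] --> x.
    rewrite -[X in _ --> X]addr0 -(scale0r v); apply: cvgD; first exact: cvg_cst.
    by apply: cvgZr_tmp; exact: cvg_id.
  by move=> /cvg_at_right_filter; exact.
move=> nB; near (0 : R)^'+ => h; exists (x + h *: v); split; near: h; assumption.
Unshelve. all: by end_near. Qed.

Lemma closure_disc (r : R) : 0 < r -> 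
  closure (@disc R r) = [set x | enorm x <= r].
Proof.
move=> r0; apply/seteqP; split=> x.
  have cl : closed [set x : 'rV[R]_2 | enorm x <= r].
    apply: (@preimage_closed _ _ (@enorm R 2) [set y | y <= r]) => [y _|].
      exact: enorm_continuous.
    exact: closed_le.
  rewrite [X in _ -> X x]((closure_id _).1 cl).
  by apply: closureS => y /= /ltW.
(* Moving towards the origin scales the norm by [1 - h], which makes it less than [r], also when [x]
   is the origin, since [0 < r]. *)
move=> /= xr; apply: (@closure_near_ray _ _ (- x)).
near=> h; rewrite /disc /= scalerN -{1}[x]scale1r -scalerBl enormZ.
have h0 : 0 < h by near: h; exact: nbhs_right_gt.
have h1 : h < 1 by near: h; exact: nbhs_right_lt.
rewrite ger0_norm ?subr_ge0 1?ltW//.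
have := enorm_ge0 x; nra.
Unshelve. all: by end_near. Qed.

Lemma boundary_disc (r : R) : 0 < r ->
  boundary (@disc R r) = [set x | enorm x = r].
Proof.
move=> r0; rewrite /boundary closure_disc// (interior_id _).1.
  apply/seteqP; split=> x /=.
    by move=> [xr /negP]; rewrite -leNgt => rx; apply/le_anti/andP.
  by move=> xr; rewrite /disc /= xr ltxx lexx.
exact: open_disc.
Qed.

Lemma annulusE (a b : R) : 0 < a -> annulus a b = [set x | a < enorm x < b].
Proof.
move=> a0; rewrite /annulus closure_disc//; apply/seteqP; split=> x /=.
  by move=> [xb /negP]; rewrite -ltNge => ->.
by move=> /andP[ax xb]; split=> //; apply/negP; rewrite -ltNge.
Qed.

Lemma open_annulus (a b : R) : open (annulus a b).
Proof.
rewrite /annulus setDE; apply: openI; first exact: open_disc.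
by rewrite openC; exact: closed_closure.
Qed.

Lemma closure_annulus (a b : R) : 0 < a -> a < b ->
  closure (annulus a b) = [set x | a <= enorm x <= b].
Proof.
move=> a0 ab; rewrite annulusE//; apply/seteqP; split=> x.
  have cl : closed [set x : 'rV[R]_2 | a <= enorm x <= b].
    rewrite (_ : [set _ | _] = @enorm R 2 @^-1` [set y | a <= y] `&`
      @enorm R 2 @^-1` [set y | y <= b]); last first.
      by apply/seteqP; split=> y /= /andP.
    by apply: closedI; apply: preimage_closed;
      [move=> y _; exact: enorm_continuous|exact: closed_ge|
       move=> y _; exact: enorm_continuous|exact: closed_le].
  rewrite [X in _ -> X x]((closure_id _).1 cl).
  by apply: closureS => y /= /andP[/ltW -> /ltW ->].
(* Points off the outer circle, those of the inner circle included, are approached from outside;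
   points of the outer circle from inside. *)
move=> /= /andP[ax xb]; have [xlb|bx] := ltP (enorm x) b.
  apply: (@closure_near_ray _ _ x).
  near=> h; rewrite /= (_ : x + h *: x = (1 + h) *: x) ?enormZ;
    last by rewrite scalerDl scale1r.
  have h0 : 0 < h by near: h; exact: nbhs_right_gt.
  have h1 : h < (b - enorm x) / enorm x.
    by near: h; apply: nbhs_right_lt; rewrite divr_gt0 ?subr_gt0//; lra.
  rewrite ger0_norm; last lra.
  move: h1; rewrite ltr_pdivlMr; last lra.
  move=> h1; have he : 0 < h * enorm x by rewrite mulr_gt0//; lra.
  by apply/andP; split; lra.
apply: (@closure_near_ray _ _ (- x)).
near=> h; rewrite /= (_ : x + h *: - x = (1 - h) *: x) ?enormZ;
  last by rewrite scalerN scalerBl scale1r.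
have h0 : 0 < h by near: h; exact: nbhs_right_gt.
have h1 : h < 1 by near: h; exact: nbhs_right_lt.
have h2 : h < (b - a) / b.
  by near: h; apply: nbhs_right_lt; rewrite divr_gt0 ?subr_gt0//; lra.
have -> : enorm x = b by apply/le_anti/andP.
rewrite ger0_norm; last lra.
move: h2; rewrite ltr_pdivlMr; last lra.
move=> h2; have hb : 0 < h * b by rewrite mulr_gt0//; lra.
by apply/andP; split; lra.
Unshelve. all: by end_near. Qed.

End PlanarCalculus.

(** * The explicit solution as a function of [t = |x|^2] *)

Section ExplicitSolution.
Context {R : realType}.
Variables (psi m : R).
Implicit Types (t : R) (x v : 'rV[R]_2).

(** Here [K] collects the terms in [R_+]. The number [m] may have either sign, so regularity at [t]
    is expressed by both [0 < t] and [m < t]. *)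
Definition profile (K t : R) : R := psi / 2 *
  (Num.sqrt t * Num.sqrt (t - m) - m * ln (Num.sqrt t + Num.sqrt (t - m)) - K).

(** The function [H] with gradient [H(|x|^2) x], i.e. twice the derivative of [profile]. *)
Definition slope t : R := psi * (Num.sqrt (t - m) / Num.sqrt t).

Definition dslope t : R :=
  psi * m / (2 * (t * (Num.sqrt t * Num.sqrt (t - m)))).

Lemma is_derive_sqrt_subr t : m < t ->
  is_derive t 1 (fun t => Num.sqrt (t - m)) (2 * Num.sqrt (t - m))^-1.
Proof.
move=> mt; have dm : is_derive t (1 : R) (fun t => t - m) 1.
  apply: (is_derive_eq (is_deriveB (is_derive_id t 1) (is_derive_cst m t 1))).
  by rewrite subr0.
have tm : 0 < t - m by rewrite subr_gt0.
apply: (is_derive_eq (@is_derive1_comp _ Num.sqrt (fun t => t - m) t _ _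
  (is_derive1_sqrt tm) dm)).
by rewrite mulr1.
Qed.

(** With [r = sqrt t] and [s = sqrt (t - m)] the logarithm has derivative [1 / (2 r s)], and
    [r^2 + s^2 - m = 2 s^2] collapses the sum to a multiple of [s / r]. *)
Lemma is_derive_profile K t : 0 < t -> m < t ->
  is_derive t 1 (profile K) (slope t / 2).
Proof.
move=> t0 mt.
have r0 : 0 < Num.sqrt t by rewrite sqrtr_gt0.
have s0 : 0 < Num.sqrt (t - m) by rewrite sqrtr_gt0 subr_gt0.
have dr := is_derive1_sqrt t0; have ds := is_derive_sqrt_subr t mt.
have dl := @is_derive1_comp _ (@ln R) (Num.sqrt + (fun t => Num.sqrt (t - m))) t _ _
  (is_derive1_ln (addr_gt0 r0 s0)) (is_deriveD dr ds).
apply: (is_derive_eq (is_deriveZ (psi / 2) (is_deriveB (is_deriveB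
  (is_deriveM dr ds) (is_deriveZ m dl)) (is_derive_cst K t 1)))).
have := sqr_sqrtr (ltW t0).
have tm0 : 0 <= t - m by rewrite subr_ge0 ltW.
have := sqr_sqrtr tm0.
rewrite /slope /GRing.scale /=.
move: r0 s0; set r := Num.sqrt t; set s := Num.sqrt (t - m) => r0 s0 sE rE.
(* Eliminating [m] makes [r] and [s] independent, so a rational identity remains. *)
have -> : m = r ^+ 2 - s ^+ 2 by rewrite sE rE opprB addrC subrK.
have rs : r + s != 0 by rewrite gt_eqF ?addr_gt0.
by field; rewrite rs !gt_eqF.
Qed.

Lemma is_derive_slope t : 0 < t -> m < t -> is_derive t 1 slope (dslope t).
Proof.
move=> t0 mt.
have r0 : 0 < Num.sqrt t by rewrite sqrtr_gt0.
have s0 : 0 < Num.sqrt (t - m) by rewrite sqrtr_gt0 subr_gt0.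
have rn0 : Num.sqrt t != 0 by rewrite gt_eqF.
have dr := is_deriveV rn0 (is_derive1_sqrt t0).
have ds := is_derive_sqrt_subr t mt.
apply: (is_derive_eq (is_deriveZ psi (is_deriveM ds dr))).
have := sqr_sqrtr (ltW t0).
have tm0 : 0 <= t - m by rewrite subr_ge0 ltW.
have := sqr_sqrtr tm0.
rewrite /dslope /GRing.scale /=.
move: r0 s0; set r := Num.sqrt t; set s := Num.sqrt (t - m) => r0 s0 sE rE.
have -> : m = r ^+ 2 - s ^+ 2 by rewrite sE rE opprB addrC subrK.
rewrite -rE; field; rewrite !gt_eqF//.
Qed.

Lemma slope_gt0 t : 0 < psi -> 0 < t -> m < t -> 0 < slope t.
Proof.
by move=> p0 t0 mt; rewrite /slope mulr_gt0// divr_gt0 ?sqrtr_gt0// subr_gt0.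
Qed.

(** The Monge-Ampere equation in the variable [t]: the factors are the tangential and radial
    eigenvalues of the Hessian. The left side is the derivative of [t H^2 = psi^2 (t - m)]. *)
Lemma slope_dslope t : 0 < t -> m < t ->
  slope t * (slope t + 2 * t * dslope t) = psi ^+ 2.
Proof.
move=> t0 mt.
have r0 : 0 < Num.sqrt t by rewrite sqrtr_gt0.
have s0 : 0 < Num.sqrt (t - m) by rewrite sqrtr_gt0 subr_gt0.
have := sqr_sqrtr (ltW t0).
have tm0 : 0 <= t - m by rewrite subr_ge0 ltW.
have := sqr_sqrtr tm0.
rewrite /dslope /slope.
move: r0 s0; set r := Num.sqrt t; set s := Num.sqrt (t - m) => r0 s0 sE rE.
have -> : m = r ^+ 2 - s ^+ 2 by rewrite sE rE opprB addrC subrK.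
by rewrite -rE; field; rewrite !gt_eqF.
Qed.

Lemma slope_continuous t : 0 < t -> m < t -> {for t, continuous slope}.
Proof.
move=> t0 mt; apply/differentiable_continuous/derivable1_diffP.
by have [] := is_derive_slope t t0 mt.
Qed.

Lemma dslope_continuous t : 0 < t -> m < t -> {for t, continuous dslope}.
Proof.
move=> t0 mt.
have rc := @sqrt_continuous R t.
have sc : {for t, continuous (fun t => Num.sqrt (t - m))}.
  apply/differentiable_continuous/derivable1_diffP.
  by have [] := is_derive_sqrt_subr t mt.
apply: cvgM; first exact: cvg_cst.
apply: cvgV.
  by rewrite !mulf_neq0 ?pnatr_eq0// ?gt_eqF ?sqrtr_gt0 ?subr_gt0.
apply: cvgM; first exact: cvg_cst.
by apply: cvgM; [exact: cvg_id|exact: cvgM].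
Qed.

Definition radial_profile (K : R) x := profile K (dot2 x x).

(** Regularity is an open condition, so the formula for a first partial derivative holds near [x]
    and can be differentiated again. *)
Lemma near_regular x : 0 < dot2 x x -> m < dot2 x x ->
  \forall y \near x, 0 < dot2 y y /\ m < dot2 y y.
Proof.
move=> x0 mx; near=> y; split; near: y.
  by apply: (cvgr_gt (dot2 x x)) => //; exact: dot2_continuous.
by apply: (cvgr_gt (dot2 x x)) => //; exact: dot2_continuous.
Unshelve. all: by end_near. Qed.

Lemma is_derive_radial_profile K x v : 0 < dot2 x x -> m < dot2 x x ->
  is_derive x v (radial_profile K) (slope (dot2 x x) * dot2 x v).
Proof.
move=> x0 mx.
apply: (is_derive_eq (@is_derive_comp_line _ _ (profile K) (fun y => dot2 y y) x v _ _
  (is_derive_profile K _ x0 mx)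
  (is_derive_dot2 x v))).
by field.
Qed.

Lemma dot2_delta x (i : 'I_2) : dot2 x (delta_mx 0 i) = x 0 i.
Proof.
have [->|->] : i = 0 \/ i = 1.
  by case: i => -[|[|]]// ?; [left|right]; exact/val_inj.
by rewrite /dot2 !mxE /= mulr1 mulr0 addr0.
by rewrite /dot2 !mxE /= mulr1 mulr0 add0r.
Qed.

Lemma partial_radial_profile K x i : 0 < dot2 x x -> m < dot2 x x ->
  partial i (radial_profile K) x = slope (dot2 x x) * x 0 i.
Proof.
move=> x0 mx; rewrite /partial.
by have [_ ->] := is_derive_radial_profile K x (delta_mx 0 i) x0 mx;
  rewrite dot2_delta.
Qed.

Lemma near_partial_radial_profile K x i : 0 < dot2 x x -> m < dot2 x x ->
  \forall y \near x, slope (dot2 y y) * y 0 i = partial i (radial_profile K) y.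
Proof.
move=> x0 mx; apply: filterS (near_regular x x0 mx) => y [y0 my].
by rewrite partial_radial_profile.
Qed.

Lemma is_derive_partial_radial_profile K x i v : 0 < dot2 x x -> m < dot2 x x ->
  is_derive x v (partial i (radial_profile K))
   (slope (dot2 x x) * v 0 i + 2 * dslope (dot2 x x) * dot2 x v * x 0 i).
Proof.
move=> x0 mx.
apply: near_eq_is_derive (near_partial_radial_profile K x i x0 mx) _.
apply: (is_derive_eq (is_deriveM (@is_derive_comp_line _ _ slope
  (fun y => dot2 y y) x v _ _ (is_derive_slope _ x0 mx)
  (is_derive_dot2 x v)) (is_derive_coord x v i))).
by rewrite /GRing.scale /=; ring.
Qed.

Lemma partial2_radial_profile K x i j : 0 < dot2 x x -> m < dot2 x x ->
  partial j (partial i (radial_profile K)) x =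
   slope (dot2 x x) * (i == j)%:R + 2 * dslope (dot2 x x) * x 0 i * x 0 j.
Proof.
move=> x0 mx; rewrite {1}/partial.
have [_ ->] := is_derive_partial_radial_profile K x i (delta_mx 0 j) x0 mx.
by rewrite dot2_delta mxE eqxx /= eq_sym; ring.
Qed.

Lemma C2_on_radial_profile K (A : set 'rV[R]_2) :
  (forall x, A x -> 0 < dot2 x x /\ m < dot2 x x) ->
  C2_on A (radial_profile K).
Proof.
move=> Areg x /Areg[x0 mx].
have cs (f : R -> R) : {for dot2 x x, continuous f} ->
    {for x, continuous (fun y : 'rV[R]_2 => f (dot2 y y))}.
  by move=> fc; apply: continuous_comp => //; exact: dot2_continuous.
split; [|split=> i].
- apply: (cs (profile K)).
  apply/differentiable_continuous/derivable1_diffP.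
  by have [] := is_derive_profile K _ x0 mx.
- split; first by have [] := is_derive_radial_profile K x (delta_mx 0 i) x0 mx.
  rewrite /prop_for /continuous_at partial_radial_profile//.
  apply: (cvg_trans (near_eq_cvg (near_partial_radial_profile K x i x0 mx))).
  by apply: cvgM; [exact/cs/slope_continuous|exact: coord_continuous].
- move=> j.
  split.
    by have [] := is_derive_partial_radial_profile K x i (delta_mx 0 j) x0 mx.
  rewrite /prop_for /continuous_at partial2_radial_profile//.
  have E : \forall y \near x, slope (dot2 y y) * (i == j)%:R
      + 2 * dslope (dot2 y y) * y 0 i * y 0 j =
      partial j (partial i (radial_profile K)) y.
    apply: filterS (near_regular x x0 mx) => y [y0 my].
    by rewrite partial2_radial_profile.
  apply: (cvg_trans (near_eq_cvg E)).
  apply: cvgD; apply: cvgM; try exact: cvg_cst; try exact: coord_continuous.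
    exact/cs/slope_continuous.
  apply: cvgM; last exact: coord_continuous.
  by apply: cvgM; [exact: cvg_cst|exact/cs/dslope_continuous].
Qed.

End ExplicitSolution.

(** * Determinant and positivity of the Hessian of the explicit solution *)

Section ExplicitSolutionConvex.
Context {R : realType}.
Variables (psi m K : R).
Implicit Types (x v : 'rV[R]_2).

Lemma quadratic_form2 (A : 'M[R]_2) v : (v *m A *m v^T) 0 0 =
  v 0 0 * A 0 0 * v 0 0 + v 0 1 * A 1 0 * v 0 0
  + v 0 0 * A 0 1 * v 0 1 + v 0 1 * A 1 1 * v 0 1.
Proof.
have E : lift ord0 ord0 = 1 :> 'I_2 by exact/val_inj.
rewrite mxE !big_ord_recl big_ord0 !mxE !big_ord_recl !big_ord0 !E.
by ring.
Qed.

Lemma det2 (A : 'M[R]_2) : \det A = A 0 0 * A 1 1 - A 0 1 * A 1 0.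
Proof.
rewrite (expand_det_row _ 0) !big_ord_recl big_ord0 /cofactor !det_mx11 !mxE /=.
have -> : lift ord0 ord0 = 1 :> 'I_2 by exact/val_inj.
have -> : lift 1 0 = 0 :> 'I_2 by exact/val_inj.
by rewrite /= /bump /=; ring.
Qed.

Lemma hessian_radial_profile x i j : 0 < dot2 x x -> m < dot2 x x ->
  hessian (radial_profile psi m K) x i j =
   slope psi m (dot2 x x) * (i == j)%:R
   + 2 * dslope psi m (dot2 x x) * x 0 i * x 0 j.
Proof. by move=> x0 mx; rewrite mxE; exact: partial2_radial_profile. Qed.

(** The Hessian is [H I + 2 H' x^T x], with determinant [H (H + 2 |x|^2 H')], so [slope_dslope]
    applies. *)
Lemma det_hessian_radial_profile x : 0 < dot2 x x -> m < dot2 x x ->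
  \det (hessian (radial_profile psi m K) x) = psi ^+ 2.
Proof.
move=> x0 mx; rewrite det2 !hessian_radial_profile// !eqxx
  (_ : (0 == 1 :> 'I_2) = false)// (_ : (1 == 0 :> 'I_2) = false)//
  !mulr1n !mulr0n.
rewrite -(slope_dslope psi m (dot2 x x))//.
set H := slope _ _ _; set H' := dslope _ _ _; rewrite /dot2; ring.
Qed.

(* Multiplied by [|x|^2] the Hessian form splits into its tangential and radial
   parts, whose coefficients are [slope] and, by [slope_dslope],
   [psi ^+ 2 / slope]. *)
Lemma posdef_hessian_radial_profile x : 0 < psi -> 0 < dot2 x x ->
  m < dot2 x x -> posdef (hessian (radial_profile psi m K) x).
Proof.
move=> p0 x0 mx; split.
  by apply/matrixP => i j; rewrite mxE !hessian_radial_profile// eq_sym; ring.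
move=> v v0; rewrite -(pmulr_rgt0 _ x0) quadratic_form2.
rewrite !hessian_radial_profile// !eqxx
  (_ : (0 == 1 :> 'I_2) = false)// (_ : (1 == 0 :> 'I_2) = false)//
  !mulr1n !mulr0n.
have s0 := slope_gt0 psi m _ p0 x0 mx.
have : 0 < slope psi m (dot2 x x) + 2 * dot2 x x * dslope psi m (dot2 x x).
  by rewrite -(pmulr_rgt0 _ s0) slope_dslope// exprn_gt0.
move: s0; set H := slope _ _ _; set H' := dslope _ _ _ => H0 N0.
pose w := x 0 0 * v 0 1 - x 0 1 * v 0 0.
rewrite [ltRHS](_ : _ = H * w ^+ 2 +
    (H + 2 * dot2 x x * H') * dot2 x v ^+ 2); last first.
  by rewrite /w /dot2; ring.
have vv : 0 < dot2 v v.
  rewrite lt_neqAle dot2_ge0 andbT eq_sym; apply: contra v0.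
  rewrite /dot2 -!expr2 paddr_eq0 ?sqr_ge0// !sqrf_eq0 => /andP[/eqP v00 /eqP v01].
  apply/eqP/rowP => i; rewrite mxE.
  have : i = 0 \/ i = 1 by case: i => -[|[|]]// ?; [left|right]; exact/val_inj.
  by case=> ->.
(* Lagrange's identity: the sum is [|x|^2 |v|^2], so the two squares do not both vanish. *)
have : 0 < w ^+ 2 + dot2 x v ^+ 2.
  rewrite (_ : _ + _ = dot2 x x * dot2 v v) ?mulr_gt0//.
  by rewrite /w /dot2; ring.
have := sqr_ge0 w; have := sqr_ge0 (dot2 x v).
set a := w ^+ 2; set b := _ ^+ 2; set N := H + _ => b0 a0 ab.
have [a00|a1] := eqVneq a 0; last first.
  by apply: ltr_pwDl; [rewrite mulr_gt0// lt_neqAle eq_sym a1|rewrite mulr_ge0// ltW].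
by rewrite a00 mulr0 add0r mulr_gt0//; rewrite a00 add0r in ab.
Qed.

End ExplicitSolutionConvex.

(** * The explicit solution satisfies the boundary value problem *)

Section ExplicitSolutionProblem.
Context {R : realType}.
Variables (Rm Rp psi gamma0 d : R).
Hypotheses (hRm : 0 < Rm) (hRp : Rm < Rp) (hpsi : 0 < psi) (hd : 0 < d).
Implicit Types (x : 'rV[R]_2).

Let m := Rm ^+ 2 - d ^+ 2 / psi ^+ 2.
Let K := Rp * Num.sqrt (Rp ^+ 2 - m) - m * ln (Rp + Num.sqrt (Rp ^+ 2 - m)).

Lemma u_ofE : u_of Rm Rp psi d = radial_profile psi m K.
Proof.
apply/funext => x; rewrite /u_of /radial_profile /profile /K /m.
rewrite enorm_sqr -enormE !opprB !addrA !(addrAC _ (d ^+ 2 / _)).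
by congr (_ * _); ring.
Qed.

(** On the closed annulus [|x|^2 >= R_-^2], and [d > 0] puts [m] strictly below [R_-^2]; hence the
    solution stays regular across the inner circle. *)
Lemma closure_annulus_regular x : closure (annulus Rm Rp) x ->
  0 < dot2 x x /\ m < dot2 x x.
Proof.
rewrite closure_annulus// => /= /andP[ax _].
have : Rm ^+ 2 <= dot2 x x.
  by rewrite -enorm_sqr ler_sqr ?nnegrE ?enorm_ge0// ltW.
have : 0 < Rm ^+ 2 by rewrite exprn_gt0.
have : 0 < d ^+ 2 / psi ^+ 2 by rewrite divr_gt0 ?exprn_gt0.
by rewrite /m; split; lra.
Qed.

Lemma radial_on_u_of (A : set 'rV[R]_2) : radial_on A (u_of Rm Rp psi d).
Proof. by move=> x y _ _ xy; rewrite /u_of xy. Qed.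

Lemma solves_problem_u_of :
  solves_problem Rm Rp psi gamma0 (phi_of Rm Rp psi gamma0 d)
    (u_of Rm Rp psi d).
Proof.
have Rp0 : 0 < Rp := lt_trans hRm hRp.
split=> x.
- move=> /subset_closure/closure_annulus_regular[x0 mx].
  by rewrite u_ofE det_hessian_radial_profile.
- rewrite boundary_disc// => xRp; rewrite /u_of xRp; ring.
- rewrite boundary_disc// => /= xRm.
  have [x0 mx] : 0 < dot2 x x /\ m < dot2 x x.
    by apply: closure_annulus_regular; rewrite closure_annulus//= xRm lexx ltW.
  (* At [|x| = R_-] the root becomes [d / psi]. Thus the normal derivative is [d], and [phi_of] is
     [d] minus [gamma0] times the value of [u] there. *)
  have sE : Num.sqrt (Rm ^+ 2 - Rm ^+ 2 + d ^+ 2 / psi ^+ 2) = d / psi.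
    by rewrite subrr add0r -expr_div_n sqrtr_sqr gtr0_norm// divr_gt0.
  have -> : gamma0 * u_of Rm Rp psi d x + phi_of Rm Rp psi gamma0 d =
      slope psi m (dot2 x x) * dot2 x (inner_normal x).
    have -> : dot2 x (inner_normal x) = enorm x.
      rewrite /inner_normal (_ : dot2 _ _ = (enorm x)^-1 * dot2 x x).
        by rewrite -enorm_sqr xRm expr2 mulKf// gt_eqF.
      by rewrite /dot2 !mxE; ring.
    rewrite /slope -enormE -enorm_sqr xRm.
    have -> : Rm ^+ 2 - m = Rm ^+ 2 - Rm ^+ 2 + d ^+ 2 / psi ^+ 2.
      by rewrite /m opprB addrA addrAC.
    rewrite sE.
    by rewrite /u_of /phi_of xRm sE; field; rewrite !gt_eqF.
  (* The two-sided derivative exists on the inner circle and yields the one-sided one. *)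
  apply: is_derive_onesided; rewrite u_ofE.
  exact: is_derive_radial_profile.
Qed.

Lemma C2_on_u_of : C2_on (closure (annulus Rm Rp)) (u_of Rm Rp psi d).
Proof.
rewrite u_ofE; apply: C2_on_radial_profile => x.
exact: closure_annulus_regular.
Qed.

Lemma strictly_convex_on_u_of :
  strictly_convex_on (closure (annulus Rm Rp)) (u_of Rm Rp psi d).
Proof.
move=> x /closure_annulus_regular[x0 mx]; rewrite u_ofE.
exact: posdef_hessian_radial_profile.
Qed.

End ExplicitSolutionProblem.

(** * Radial solutions reduced to an ordinary differential equation on an axis *)

Section RadialFunctions.
Context {R : realType}.
Implicit Types (x v : 'rV[R]_2).

Lemma is_derive_enorm x v : 0 < enorm x ->
  is_derive x v (@enorm R 2) (dot2 x v / enorm x).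
Proof.
move=> x0; have xx0 : 0 < dot2 x x by rewrite -enorm_sqr exprn_gt0.
rewrite (_ : @enorm R 2 = Num.sqrt \o (fun y => dot2 y y)); last first.
  by apply/funext => y; rewrite enormE.
apply: (is_derive_eq (@is_derive_comp_line _ _ Num.sqrt (fun y => dot2 y y) x v
  _ _ (is_derive1_sqrt xx0) (is_derive_dot2 x v))).
by rewrite /= -enormE; field; rewrite gt_eqF.
Qed.

Definition axis_point (r : R) : 'rV[R]_2 := r *: delta_mx 0 0.

Lemma enorm_axis_point r : 0 <= r -> enorm (axis_point r) = r.
Proof.
move=> r0; rewrite enormZ ger0_norm// enormE /dot2 !mxE /=.
by rewrite mulr1 mulr0 addr0 sqrtr1 mulr1.
Qed.

Lemma axis_point1 r : axis_point r 0 1 = 0.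
Proof. by rewrite !mxE /= mulr0. Qed.

Lemma is_derive_axis (f : 'rV[R]_2 -> R) (r l : R) :
  is_derive (axis_point r) (delta_mx 0 0) f l ->
  is_derive r 1 (f \o axis_point) l.
Proof.
rewrite -[X in is_derive X](addr0 (axis_point r)) => /is_derive_line.
by under eq_fun do rewrite addr0.
Qed.

Section Annulus.
Variables (a b psi : R) (u : 'rV[R]_2 -> R).
Hypothesis a0 : 0 < a.
Hypothesis uC2 : C2_on (annulus a b) u.
Hypothesis ucvx : strictly_convex_on (annulus a b) u.
Hypothesis urad : radial_on (annulus a b) u.
Hypothesis udet : forall x, annulus a b x -> \det (hessian u x) = psi ^+ 2.

Let f := u \o axis_point.
Let p := partial 0 u \o axis_point.

Lemma annulus_axis_point r : a < r < b -> annulus a b (axis_point r).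
Proof.
move=> /andP[ar rb]; rewrite annulusE//= enorm_axis_point ?ar//.
by rewrite ltW// (lt_trans a0).
Qed.

Lemma is_derive_radial r : a < r < b -> is_derive r 1 f (p r).
Proof.
move=> /annulus_axis_point/uC2[_ [/(_ 0)[du _] _]].
by apply: is_derive_axis; exact: DeriveDef.
Qed.

Lemma is_derive_partial_axis r : a < r < b ->
  is_derive r 1 p (partial 0 (partial 0 u) (axis_point r)).
Proof.
move=> /annulus_axis_point/uC2[_ [_ /(_ 0 0)[du _]]].
by apply: is_derive_axis; exact: DeriveDef.
Qed.

(** Near [x] radiality gives [u y = f |y|], so the derivative along the axis determines the whole
    gradient. *)
Lemma partial_radial x i : annulus a b x ->
  partial i u x = p (enorm x) / enorm x * x 0 i.
Proof.
move=> ax; have := ax; rewrite annulusE//= => abx.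
have x0 : 0 < enorm x by case/andP: abx => + _; exact: lt_trans.
have : is_derive x (delta_mx 0 i) u
    (p (enorm x) * (dot2 x (delta_mx 0 i) / enorm x)).
  have E : \forall y \near x, (f \o @enorm R 2) y = u y.
    have := open_annulus a b; rewrite openE => /(_ x ax).
    apply: filterS => y ay; apply: urad => //.
      by apply: annulus_axis_point; move: ay; rewrite annulusE.
    by rewrite enorm_axis_point ?enorm_ge0.
  apply: near_eq_is_derive E _.
  exact: (@is_derive_comp_line _ _ f (@enorm R 2) x _ _ _
    (is_derive_radial _ abx) (is_derive_enorm x _ x0)).
by move=> [_]; rewrite /partial => ->; rewrite dot2_delta; ring.
Qed.

(** The derivative in question is that of [k |y|] times the coordinate of index 1, where
    [k s = p s / s]. That coordinate vanishes on the axis, which kills the term in [k']. *)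
Lemma partial_tangential r i : a < r < b ->
  partial i (partial 1 u) (axis_point r) = p r / r * (i == 1)%:R.
Proof.
move=> abr; have ar := annulus_axis_point _ abr.
have r0 : 0 < r by case/andP: abr => + _; exact: lt_trans.
have er := enorm_axis_point _ (ltW r0).
pose k s := p s / s.
have [k' dk] : exists k', is_derive (enorm (axis_point r)) 1 k k'.
  have dV := @is_deriveV _ id r _ _ (lt0r_neq0 r0) (is_derive_id r 1).
  by rewrite er; eexists; exact: is_deriveM (is_derive_partial_axis _ abr) dV.
have E : \forall y \near axis_point r,
    ((k \o @enorm R 2) * (fun y : 'rV[R]_2 => y 0 1)) y = partial 1 u y.
  have := open_annulus a b; rewrite openE => /(_ _ ar).
  by apply: filterS => y ay; rewrite partial_radial.
have re0 : 0 < enorm (axis_point r) by rewrite er.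
have dr := @is_derive_comp_line _ _ k (@enorm R 2) _ _ _ _ dk
  (is_derive_enorm _ (delta_mx 0 i) re0).
have [_ D] := near_eq_is_derive E (is_deriveM dr (is_derive_coord _ _ 1)).
rewrite [LHS]D axis_point1 scale0r addr0 /= er.
by rewrite /GRing.scale /= mxE eqxx eq_sym.
Qed.

(** Convexity in the tangential direction gives [p r / r > 0]; this fixes the sign of the root when
    [p] is recovered from [p^2]. *)
Lemma partial_axis_gt0 r : a < r < b -> 0 < p r.
Proof.
move=> abr; have r0 : 0 < r by case/andP: abr => + _; exact: lt_trans.
have [_ /(_ (delta_mx 0 1))] := ucvx _ (annulus_axis_point _ abr).
have -> : delta_mx 0 1 != 0 :> 'rV[R]_2.
  by apply/eqP => /rowP/(_ 1)/eqP; rewrite !mxE/= oner_eq0.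
have q (A : 'M[R]_2) :
    ((delta_mx 0 1 : 'rV[R]_2) *m A *m (delta_mx 0 1 : 'rV[R]_2)^T) 0 0 = A 1 1.
  by rewrite quadratic_form2 !mxE /=; ring.
by move=> /(_ isT); rewrite q mxE partial_tangential// mulr1 pmulr_lgt0// invr_gt0.
Qed.

(* On the axis the mixed derivative vanishes and the tangential one is [p r / r],
   so the Monge-Ampere equation reads [p p' = psi^2 r]. *)
Lemma radial_monge_ampere r : a < r < b ->
  p r * partial 0 (partial 0 u) (axis_point r) = psi ^+ 2 * r.
Proof.
move=> abr; have r0 : 0 < r by case/andP: abr => + _; exact: lt_trans.
have E (A : 'M[R]_2) c : A 1 0 = 0 -> A 1 1 = c -> \det A = A 0 0 * c.
  by move=> A10 A11; rewrite det2 A10 A11 mulr0 subr0.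
rewrite -(udet _ (annulus_axis_point _ abr)) (E _ (p r / r)).
- by rewrite [hessian _ _ _ _]mxE; field; rewrite gt_eqF.
- by rewrite mxE partial_tangential// mulr0.
- by rewrite mxE partial_tangential// mulr1.
Qed.

Lemma is_derive0_oo_cst (g : R -> R) :
  (forall r, a < r < b -> is_derive r 1 g 0) ->
  forall r s, a < r < b -> a < s < b -> g r = g s.
Proof.
move=> dg r s; wlog rs : r s / r <= s.
  by move=> H ar bs; case/orP: (le_total r s) => ?; [|symmetry]; exact: H.
move=> /andP[ar rb] /andP[as_ sb].
have sub t : r <= t <= s -> a < t < b.
  by move=> /andP[rt ts]; rewrite (lt_le_trans ar)//= (le_lt_trans ts).
have dgrs t : t \in `]r, s[ -> is_derive t 1 g 0.
  by rewrite in_itv /= => /andP[/ltW rt /ltW ts]; apply/dg/sub; rewrite rt.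
have cg : {within `[r, s], continuous g}.
  apply: derivable_within_continuous => t; rewrite in_itv /= => rts.
  by have [] := dg _ (sub _ rts).
have [c _] := @MVT_segment _ g (fun=> 0) r s rs dgrs cg.
by rewrite mul0r => /eqP; rewrite subr_eq0 => /eqP.
Qed.

(** By [radial_monge_ampere], [p^2 - psi^2 r^2] has derivative [2 (p p' - psi^2 r) = 0]. *)
Lemma radial_first_integral :
  exists C, forall r, a < r < b -> p r ^+ 2 = psi ^+ 2 * r ^+ 2 + C.
Proof.
pose g r := p r * p r - psi ^+ 2 * (r * r).
have dg r : a < r < b -> is_derive r 1 g 0.
  move=> abr; have dp := is_derive_partial_axis _ abr.
  apply: (is_derive_eq (is_deriveB (is_deriveM dp dp) (is_deriveZ (psi ^+ 2)
    (is_deriveM (is_derive_id r 1) (is_derive_id r 1))))).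
  rewrite /GRing.scale /= radial_monge_ampere//; ring.
(* The midpoint is a reference point that lies in the interval as soon as some [r] does. *)
exists (g ((a + b) / 2)) => r abr.
rewrite -(is_derive0_oo_cst g dg r)//; first by rewrite /g; ring.
by apply/andP; split; lra.
Qed.

End Annulus.

(** The mean value theorem gives [F (a + h) - F a >= c h]. The uniform bound [c] keeps the
    inequality strict in the limit: [l >= c > 0]. *)
Lemma onesided_derivative_gt0 (F dF : R -> R) (a b c l : R) : a < b -> 0 < c ->
  (forall r, a < r < b -> is_derive r 1 F (dF r)) ->
  {within `[a, b], continuous F} ->
  (forall r, a < r < b -> c <= dF r) ->
  h^-1 * (F (a + h) - F a) @[h --> 0^'+] --> l ->
  F a < F b /\ 0 < l.
Proof.
move=> ab c0 dF1 Fc cdF Fl.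
have inc h : 0 < h -> a + h <= b -> c * h <= F (a + h) - F a.
  move=> h0 ahb; have aah : a < a + h by rewrite ltrDl.
  have [t| |s] := @MVT _ F dF a (a + h) aah.
  - rewrite in_itv /= => /andP[at_ tah]; apply: dF1.
    by rewrite at_ (lt_le_trans tah).
  - apply: continuous_subspaceW Fc => t /=.
    by rewrite !in_itv /= => /andP[-> /le_trans]; exact.
  - rewrite in_itv /= => /andP[as_ sah] ->; rewrite addrAC subrr add0r.
    by rewrite ler_pM2r//; apply: cdF; rewrite as_ (lt_le_trans sah).
split.
  have := inc (b - a); rewrite subr_gt0 addrC subrK lexx => /(_ ab isT).
  rewrite -subr_gt0; apply: lt_le_trans; rewrite mulr_gt0// subr_gt0//.
apply: (lt_le_trans c0); rewrite -(cvg_lim _ Fl)//; apply: limr_ge.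
  by apply/cvg_ex; exists l.
near=> h.
have h0 : 0 < h by near: h; exact: nbhs_right_gt.
have hb : h < b - a by near: h; apply: nbhs_right_lt; rewrite subr_gt0.
rewrite ler_pdivlMl// mulrC; apply: inc => //; lra.
Unshelve. all: by end_near. Qed.

(** * Comparison of first integrals and uniqueness *)

Section Uniqueness.
Variables (Rm Rp psi gamma0 phi : R).
Hypotheses (hRm : 0 < Rm) (hRp : Rm < Rp) (hgamma0 : 0 <= gamma0).

(** The competitors for uniqueness: less regularity at the boundary than the explicit solution
    enjoys makes the uniqueness statement stronger. *)
Definition strictly_convex_radial_solution (u : 'rV[R]_2 -> R) : Prop :=
  [/\ C2_on (annulus Rm Rp) u,
      {within closure (annulus Rm Rp), continuous u},
      strictly_convex_on (annulus Rm Rp) u,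
      radial_on (closure (annulus Rm Rp)) u
    & solves_problem Rm Rp psi gamma0 phi u].

Implicit Types u : 'rV[R]_2 -> R.

Let Rp0 : 0 < Rp := lt_trans hRm hRp.

Lemma closure_annulus_axis_point r :
  r \in `[Rm, Rp] -> closure (annulus Rm Rp) (axis_point r).
Proof.
rewrite in_itv /= => /andP[ar rb]; rewrite closure_annulus//= enorm_axis_point ?ar//.
by rewrite (le_trans (ltW hRm)).
Qed.

Lemma within_continuous_axis u :
  {within closure (annulus Rm Rp), continuous u} ->
  {within `[Rm, Rp], continuous (u \o axis_point)}.
Proof.
move=> /subspace_continuousP uc; apply/subspace_continuousP => r rab B uB.
have ucB := uc _ (closure_annulus_axis_point _ rab) B uB.
have axc : s *: (delta_mx 0 0 : 'rV[R]_2) @[s --> r] --> axis_point r.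
  apply: (@cvgZr_tmp _ _ R (nbhs r) _ id r (delta_mx 0 0 : 'rV[R]_2)).
  exact: cvg_id.
apply: (@filterS R (nbhs r) _ _ _ _ (axc _ ucB)) => s /= sB sab.
exact: (sB (closure_annulus_axis_point s sab)).
Qed.

(** Collects the one-variable data on which the comparison of two solutions rests. *)
Lemma strictly_convex_radial_solution_axis u :
  strictly_convex_radial_solution u ->
  let p := partial 0 u \o axis_point in
  [/\ (forall r, Rm < r < Rp -> is_derive r 1 (u \o axis_point) (p r)),
      {within `[Rm, Rp], continuous (u \o axis_point)},
      exists C, forall r, Rm < r < Rp ->
        0 < p r /\ p r ^+ 2 = psi ^+ 2 * r ^+ 2 + C,
      (u \o axis_point) Rp = 0 &
      h^-1 * ((u \o axis_point) (Rm + h) - (u \o axis_point) Rm) @[h --> 0^'+]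
        --> gamma0 * (u \o axis_point) Rm + phi].
Proof.
move=> [uC2 uc ucvx urad [udet u0 un]] p.
have urad' : radial_on (annulus Rm Rp) u.
  by move=> x y ax ay; apply: urad; exact: subset_closure.
have [C pC] := radial_first_integral _ _ _ _ hRm uC2 urad' udet.
split.
- by move=> r; exact: is_derive_radial.
- exact: within_continuous_axis.
- exists C => r abr; split; last exact: pC.
  exact: (partial_axis_gt0 _ _ _ hRm uC2 ucvx urad').
- by apply: u0; rewrite boundary_disc//= enorm_axis_point// ltW.
- have eRm := enorm_axis_point _ (ltW hRm).
  have := un (axis_point Rm); rewrite boundary_disc//= => /(_ eRm).
  (* At this point the inner normal is the unit vector of the axis, so the quotient stays on the
     axis. *)
  rewrite /is_onesided_derivative /inner_normal eRm scalerK ?gt_eqF//.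
  by under eq_fun do rewrite -scalerDl.
Qed.

(* A larger first integral makes [u1 - u2] increase at a definite rate, from a
   negative value at [Rm] to [0] at [Rp]; but the Robin condition forces its
   derivative at [Rm] to have the sign of [gamma0 * (u1 - u2)]. *)
Lemma first_integral_le {u1 u2 : 'rV[R]_2 -> R} {C1 C2 : R} :
  strictly_convex_radial_solution u1 -> strictly_convex_radial_solution u2 ->
  (forall r, Rm < r < Rp ->
    (partial 0 u1 \o axis_point) r ^+ 2 = psi ^+ 2 * r ^+ 2 + C1) ->
  (forall r, Rm < r < Rp ->
    (partial 0 u2 \o axis_point) r ^+ 2 = psi ^+ 2 * r ^+ 2 + C2) ->
  C1 <= C2.
Proof.
move=> /strictly_convex_radial_solution_axis [d1 c1 [C1' p1] b1 n1].
move=> /strictly_convex_radial_solution_axis [d2 c2 [C2' p2] b2 n2] pC1 pC2.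
rewrite leNgt; apply/negP => C21.
set f1 := u1 \o axis_point in d1 c1 b1 n1.
set f2 := u2 \o axis_point in d2 c2 b2 n2.
set q1 := _ \o axis_point in d1 p1 pC1; set q2 := _ \o axis_point in d2 p2 pC2.
(* [M] bounds [q1 + q2], since [t <= 1 + t^2]; then [q1 - q2 = (C1 - C2) / (q1 + q2)] is at least
   [(C1 - C2) / M]. *)
pose M := (1 + psi ^+ 2 * Rp ^+ 2 + `|C1|) + (1 + psi ^+ 2 * Rp ^+ 2 + `|C2|).
have P0 : 0 <= psi ^+ 2 * Rp ^+ 2 by rewrite mulr_ge0 ?sqr_ge0.
have M0 : 0 < M by have := normr_ge0 C1; have := normr_ge0 C2; rewrite /M; lra.
have [] := @onesided_derivative_gt0 (f1 - f2) (q1 - q2) Rm Rp ((C1 - C2) / M)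
  (gamma0 * f1 Rm + phi - (gamma0 * f2 Rm + phi)) hRp.
- by rewrite divr_gt0// subr_gt0.
- by move=> r abr; exact: is_deriveB (d1 r abr) (d2 r abr).
- by move=> r; apply: cvgB; [exact: c1|exact: c2].
- move=> r abr; rewrite ler_pdivrMr//.
  have [[q10 _] [q20 _]] := (p1 r abr, p2 r abr).
  have := pC1 r abr; have := pC2 r abr.
  have : psi ^+ 2 * r ^+ 2 <= psi ^+ 2 * Rp ^+ 2.
    case/andP: abr => ar rb; rewrite ler_wpM2l ?sqr_ge0// ler_sqr ?nnegrE ltW//.
    exact: lt_trans ar.
  rewrite /M !fctE; have := ler_norm C1; have := ler_norm C2.
  move: q10 q20; set x := q1 r; set y := q2 r => x0 y0 C2n C1n rR y2 x2.
  have xy : 0 < x - y.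
    by rewrite subr_gt0 -ltr_sqr ?nnegrE ?ltW//; lra.
  have -> : C1 - C2 = (x - y) * (x + y) by rewrite -subr_sqr x2 y2; ring.
  rewrite ler_pM2l//.
  have := sqr_ge0 (x - 1); have := sqr_ge0 (y - 1); rewrite !sqrrB1; nra.
- rewrite (_ : (fun h => _) = (fun h => h^-1 * (f1 (Rm + h) - f1 Rm)) -
    (fun h => h^-1 * (f2 (Rm + h) - f2 Rm))); first exact: cvgB.
  by apply/funext => h; rewrite !fctE; ring.
rewrite !fctE b1 b2 subrr => f120.
rewrite (_ : _ - _ = gamma0 * (f1 Rm - f2 Rm)); last ring.
by rewrite ltNge; move/negP; apply; rewrite mulr_ge0_le0// ltW.
Qed.

Lemma strictly_convex_radial_solution_unique u1 u2 x :
  strictly_convex_radial_solution u1 -> strictly_convex_radial_solution u2 ->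
  closure (annulus Rm Rp) x -> u1 x = u2 x.
Proof.
move=> s1 s2 ax.
have [d1 c1 [C1 p1] b1 _] := strictly_convex_radial_solution_axis _ s1.
have [d2 c2 [C2 p2] b2 _] := strictly_convex_radial_solution_axis _ s2.
have pC1 r abr := (p1 r abr).2; have pC2 r abr := (p2 r abr).2.
have C12 : C1 = C2.
  apply/le_anti; rewrite (first_integral_le s1 s2 pC1 pC2).
  by rewrite (first_integral_le s2 s1 pC2 pC1).
have := ax; rewrite closure_annulus//= => xab.
have eax : closure (annulus Rm Rp) (axis_point (enorm x)).
  by apply: closure_annulus_axis_point; rewrite in_itv.
have rad u : strictly_convex_radial_solution u ->
    u x = (u \o axis_point) (enorm x).
  by move=> [_ _ _ urad _]; apply: urad; rewrite // enorm_axis_point ?enorm_ge0.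
rewrite (rad _ s1) (rad _ s2); apply/eqP; rewrite -subr_eq0; apply/eqP.
move: xab; set r := enorm x => /andP[ar rb].
(* The difference is followed from [|x|] out to [R_+], where both solutions vanish. *)
pose F := (u1 \o axis_point) - (u2 \o axis_point).
have Fc : {within `[r, Rp], continuous F}.
  apply: (@continuous_subspaceW _ _ _ `[Rm, Rp]).
    by move=> t /=; rewrite !in_itv /= => /andP[/(le_trans ar) -> ->].
  by move=> t; apply: cvgB; [exact: c1|exact: c2].
have dF t : t \in `]r, Rp[ -> is_derive t 1 F 0.
  rewrite in_itv /= => /andP[rt tb].
  have abt : Rm < t < Rp by rewrite (le_lt_trans ar rt) tb.
  apply: (is_derive_eq (is_deriveB (d1 t abt) (d2 t abt))).
  (* Both radial derivatives are positive, so equality of their squares suffices. *)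
  apply/eqP; rewrite subr_eq0 -(eqrXn2 (n := 2))// ?ltW ?(p1 t abt).1 ?(p2 t abt).1//.
  by rewrite pC1// pC2// C12.
have [c _] := @MVT_segment _ F (fun=> 0) r Rp rb dF Fc.
have FRp : F Rp = 0.
  by rewrite /F -[LHS]/((u1 \o _) Rp - (u2 \o _) Rp) b1 b2 subrr.
by rewrite mul0r FRp sub0r => /eqP; rewrite oppr_eq0 => /eqP.
Qed.

End Uniqueness.
End RadialFunctions.

Theorem proposition2p14 (R : realType) (Rm Rp psi gamma0 : R) (d : nat -> R)
    (hRm : 0 < Rm) (hRp : Rm < Rp) (hpsi : 0 < psi) (hgamma0 : 0 <= gamma0)
    (hd : forall k, 0 < d k) (hd0 : d k @[k --> \oo] --> (0 : R)) :
  forall k : nat,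
    [/\ C2_on (closure (annulus Rm Rp)) (u_of Rm Rp psi (d k)),
        strictly_convex_on (closure (annulus Rm Rp)) (u_of Rm Rp psi (d k)),
        radial_on (closure (annulus Rm Rp)) (u_of Rm Rp psi (d k))
      & solves_problem Rm Rp psi gamma0 (phi_of Rm Rp psi gamma0 (d k))
          (u_of Rm Rp psi (d k))] /\
    (forall u : 'rV[R]_2 -> R,
       C2_on (annulus Rm Rp) u ->
       {within closure (annulus Rm Rp), continuous u} ->
       strictly_convex_on (annulus Rm Rp) u ->
       radial_on (closure (annulus Rm Rp)) u ->
       solves_problem Rm Rp psi gamma0 (phi_of Rm Rp psi gamma0 (d k)) u ->
       forall x, closure (annulus Rm Rp) x -> u x = u_of Rm Rp psi (d k) x).
Proof.
move=> k.
have uC2 := C2_on_u_of Rm Rp psi (d k) hRm hRp hpsi (hd k).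
have ucvx := strictly_convex_on_u_of Rm Rp psi (d k) hRm hRp hpsi (hd k).
have urad := radial_on_u_of Rm Rp psi (d k) (closure (annulus Rm Rp)).
have usol := solves_problem_u_of Rm Rp psi gamma0 (d k) hRm hRp hpsi (hd k).
split; first by split.
move=> u vC2 vc vcvx vrad vsol x ax.
apply: (strictly_convex_radial_solution_unique Rm Rp psi gamma0
  (phi_of Rm Rp psi gamma0 (d k)) hRm hRp hgamma0 u _ x _ _ ax); first by split.
split; [| | |exact: urad|exact: usol].
- by move=> y /subset_closure/uC2.
(* The explicit solution is continuous in the plane at each point of the closed annulus, hence
   relative to it. *)
- apply/subspace_continuousP => y ay; apply: cvg_within_filter.
  by have [] := uC2 y ay.
- by move=> y /subset_closure/ucvx.
Qed.
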